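(* Let $T>0$, $p>1$, $x\in C^0([0,T])$, and let $\pi=(\pi^n)_{n\ge0}$ be a balanced, convergent refining partition sequence of $[0,T]$. Denote $$\xi^{\pi,(p)}_n:=|\pi^n|^{\frac p2}\Big(\sum_{k\in I_n}|\theta^{x,\pi}_{n,k}|^p\Big),\qquad n\ge0.$$ Then $$\limsup_{n\to\infty}[x]^{(p)}_{\pi^n}(T)<\infty\quad\text{if and only if}\quad\limsup_{n\to\infty}\xi^{\pi,(p)}_n<\infty .$$ Thus, also, $x\in\mathcal{X}^p_\pi$ if and only if $\limsup_{n\to\infty}\xi^{\pi,(p)}_n<\infty$.
   Context: $C^0([0,T])$ is the space of real-valued continuous functions on $[0,T]$. A sequence of partitions $\pi=(\pi^n)_{n\ge0}$ of $[0,T]$ is written $\pi^n=(0=t^n_0<t^n_1<\cdots<t^n_{N(\pi^n)}=T)$, with $\pi^0=\{0,T\}$. It is refining if $\pi^0\subseteq\pi^1\subseteq\cdots$. Write $\underline{\pi^n}:=\inf_i|t^n_{i+1}-t^n_i|$ and $|\pi^n|:=\sup_i|t^n_{i+1}-t^n_i|$. $\Pi([0,T])$ is the collection of all refining partition sequences with $|\pi^n|\to0$. Types of partition sequences. $\pi\in\Pi([0,T])$ is finitely refining if there is a positive integer $M$ such that the number of partition points of $\pi^{n+1}$ within any two consecutive partition points of $\pi^n$ is bounded above by $M$ for all $n\ge0$ (i.e. each interval of $\pi^n$ is divided into at most $M$ intervals of $\pi^{n+1}$; in particular $N(\pi^n)\le M^n$). It is balanced if there is $c>1$ with $|\pi^n|/\underline{\pi^n}\le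 c$ for every $n\in\mathbb{N}$. It is complete refining if it is finitely refining and there are positive constants $a,b$ with $1+a\le|\pi^n|/|\pi^{n+1}|\le b$ for every $n\in\mathbb{N}$. It is convergent refining if it is complete refining and $\lim_{n\to\infty}|\pi^n|/|\pi^{n+1}|=r\in(1,\infty)$ exists. Variation. $[x]^{(p)}_{\pi^n}(T):=\sum_{j=0}^{N(\pi^n)-1}|x(t^n_{j+1})-x(t^n_j)|^p$; $\Vert x\Vert^{(p)}_\pi:=|x(0)|+\sup_{n\in\mathbb{N}}([x]^{(p)}_{\pi^n}(T))^{1/p}$; $\mathcal{X}^p_\pi:=\{x\in C^0([0,T]):\Vert x\Vert^{(p)}_\pi<\infty\}$. Schauder coefficients. Let $p(m,k):=\inf\{j\ge0:t^{m+1}_j\ge t^m_k\}$, so $t^m_k=t^{m+1}_{p(m,k)}$. For $m\ge0$, $0\le k\le N(\pi^m)-1$, $2\le i\le p(m,k+1)-p(m,k)$, put $t_1=t^{m+1}_{p(m,k)}$, $t_2=t^{m+1}_{p(m,k)+i-1}$, $t_3=t^{m+1}_{p(m,k)+i}$ and $$\theta^{x,\pi}_{m,k,i}:=\frac{(x(t_2)-x(t_1))(t_3-t_2)-(x(t_3)-x(t_2))(t_2-t_1)}{\sqrt{(t_2-t_1)(t_3-t_2)(t_3-t_1)}} .$$ For each $m$, these coefficients (over all pairs $(k,i)$) are re-indexed as $\theta^{x,\pi}_{m,k}$, $k\in I_m:=\{0,1,\dots,N(\pi^{m+1})-N(\pi^m)-1\}$. *)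

(* Defs.v *)
From HB Require Import structures.
From mathcomp Require Import all_boot all_order all_algebra.
From mathcomp Require Import all_classical all_reals all_analysis.

Set Implicit Arguments.
Unset Strict Implicit.
Unset Printing Implicit Defensive.

Import Order.TTheory GRing.Theory Num.Theory.
Import numFieldNormedType.Exports.

Local Open Scope classical_set_scope.
Local Open Scope ring_scope.

(* A sequence of partitions of [0, T] is a function pi : nat -> seq R where,
   as in itv_partition, the leading point 0 is left implicit: pi n lists
   t^n_1 < ... < t^n_N = T. *)

Section Partitions.
Context {R : realType}.
Implicit Types (T : R) (pi : nat -> seq R).

Definition partition_seq T pi :=
  pi 0%N = [:: T] /\ forall n, itv_partition 0 T (pi n).

Definition pts pi n : seq R := 0 :: pi n.

(* The number N(pi^n) of intervals; pi^n has N(pi^n) + 1 points. *)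
Definition nint pi n : nat := size (pi n).

(* t^n_j, meaningful for j <= nint pi n. *)
Definition tpt pi n j : R := (pts pi n)`_j.

Definition mesh pi n : R :=
  sup [set `|tpt pi n i.+1 - tpt pi n i| | i in `I_(nint pi n)].

Definition min_mesh pi n : R :=
  inf [set `|tpt pi n i.+1 - tpt pi n i| | i in `I_(nint pi n)].

Definition refining pi := forall n, {subset pts pi n <= pts pi n.+1}.

(* The class Pi([0, T]). *)
Definition vanishing_refining T pi :=
  [/\ partition_seq T pi, refining pi & mesh pi n @[n --> \oo] --> (0 : R)].

(* p(m, k) = inf {j >= 0 : t^{m+1}_j >= t^m_k}. *)
Definition pidx pi m k : nat := find (fun s => tpt pi m k <= s) (pts pi m.+1).

Definition finitely_refining pi :=
  exists2 M, (0 < M)%N &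
    forall n k, (k < nint pi n)%N -> (pidx pi n k.+1 - pidx pi n k <= M)%N.

Definition balanced pi :=
  exists2 c : R, 1 < c & forall n, mesh pi n / min_mesh pi n <= c.

Definition complete_refining pi :=
  finitely_refining pi /\
  exists a b : R, [/\ 0 < a, 0 < b &
    forall n, 1 + a <= mesh pi n / mesh pi n.+1 <= b].

Definition convergent_refining pi :=
  complete_refining pi /\
  exists2 r : R, 1 < r & mesh pi n / mesh pi n.+1 @[n --> \oo] --> r.

End Partitions.

Section Variation.
Context {R : realType}.
Implicit Types (T p : R) (pi : nat -> seq R) (x : R -> R).

(* A real-valued function on [0, T] is represented by a function on R, of which
   only the values on [0, T] matter. *)
Definition C0 T : set (R -> R) := [set x | {within `[0, T], continuous x}].

Definition pvar p pi n x : R :=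
  \sum_(j < nint pi n) `|x (tpt pi n j.+1) - x (tpt pi n j)| `^ p.

Definition pvar_norm p pi x : \bar R :=
  (`|x 0|%:E + ereal_sup (range (fun n => (pvar p pi n x `^ p^-1)%:E)))%E.

Definition pvar_space T p pi : set (R -> R) :=
  [set x | C0 T x /\ (pvar_norm p pi x < +oo)%E].

End Variation.

Section Schauder.
Context {R : realType}.
Implicit Types (p : R) (pi : nat -> seq R) (x : R -> R).

(* theta^{x, pi}_{m, k, i} *)
Definition schauder3 pi x m k i : R :=
  let t1 := tpt pi m.+1 (pidx pi m k) in
  let t2 := tpt pi m.+1 (pidx pi m k + i - 1) in
  let t3 := tpt pi m.+1 (pidx pi m k + i) in
  ((x t2 - x t1) * (t3 - t2) - (x t3 - x t2) * (t2 - t1)) /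
  Num.sqrt ((t2 - t1) * (t3 - t2) * (t3 - t1)).

(* All theta^{x, pi}_{m, k, i} with 0 <= k <= N(pi^m) - 1 and
   2 <= i <= p(m, k+1) - p(m, k), in lexicographic order of (k, i). *)
Definition schauder_seq pi x m : seq R :=
  [seq schauder3 pi x m k i | k <- index_iota 0 (nint pi m),
     i <- index_iota 2 (pidx pi m k.+1 - pidx pi m k).+1].

(* The re-indexed theta^{x, pi}_{m, k}, for k in I_m (see size_schauder_seq). *)
Definition schauder pi x m k : R := (schauder_seq pi x m)`_k.

Definition xi p pi x n : R :=
  mesh pi n `^ (p / 2) *
  \sum_(k < nint pi n.+1 - nint pi n) `|schauder pi x n k| `^ p.

Section Size.
Variables (T : R) (pi : nat -> seq R).
Hypotheses (hpi : partition_seq T pi) (href : refining pi).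

Let pts_sorted n : sorted <%R (pts pi n).
Proof. by have [/= ? _] := hpi.2 n. Qed.

Let tpt_last n : tpt pi n (nint pi n) = T.
Proof.
have [_ /eqP <-] := hpi.2 n.
by rewrite /tpt /pts /nint (last_nth 0).
Qed.

Let pidxE m k : (k <= nint pi m)%N ->
  (pidx pi m k <= nint pi m.+1)%N /\ tpt pi m.+1 (pidx pi m k) = tpt pi m k.
Proof.
move=> km; have tin : tpt pi m k \in pts pi m.+1.
  by apply: href; apply: mem_nth; rewrite /= ltnS.
have hh : has (fun s => tpt pi m k <= s) (pts pi m.+1).
  by apply/hasP; exists (tpt pi m k).
have ps : (pidx pi m k < size (pts pi m.+1))%N by rewrite /pidx -has_find.
split; first by move: ps; rewrite /= ltnS.
apply/eqP; rewrite eq_le; apply/andP; split; last exact: (nth_find 0 hh).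
have il : (index (tpt pi m k) (pts pi m.+1) < size (pts pi m.+1))%N.
  by rewrite index_mem.
rewrite -[leRHS](nth_index 0 tin).
have [/= lt|] := ltnP (index (tpt pi m k) (pts pi m.+1)) (pidx pi m k).
  have := before_find 0 lt; rewrite nth_index// lexx.
  by [].
rewrite leq_eqVlt => /predU1P[e|lt]; first by rewrite /tpt {1}e.
by apply/ltW/(sorted_ltn_nth lt_trans).
Qed.

Let pidx_lt m k : (k < nint pi m)%N -> (pidx pi m k < pidx pi m k.+1)%N.
Proof.
move=> km; have [a1 e1] := pidxE (ltnW km); have [a2 e2] := pidxE km.
have : tpt pi m k < tpt pi m k.+1.
  by apply: (sorted_ltn_nth lt_trans) => //; rewrite inE /= ltnS// ltnW.
rewrite -e1 -e2 ltNge; apply: contraNltn.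
rewrite leq_eqVlt => /predU1P[->//|lt].
by apply/ltW/(sorted_ltn_nth lt_trans).
Qed.

Let pidx0 m : pidx pi m 0 = 0%N.
Proof. by rewrite /pidx /= lexx. Qed.

Let pidxN m : pidx pi m (nint pi m) = nint pi m.+1.
Proof.
have [a e] := pidxE (leqnn (nint pi m)).
move: a; rewrite leq_eqVlt => /predU1P[//|lt].
have : tpt pi m.+1 (pidx pi m (nint pi m)) < tpt pi m.+1 (nint pi m.+1).
  by apply: (sorted_ltn_nth lt_trans) => //; rewrite inE /= ltnS// ltnW.
by rewrite e !tpt_last ltxx.
Qed.

Lemma size_schauder_seq x m :
  size (schauder_seq pi x m) = (nint pi m.+1 - nint pi m)%N.
Proof.
rewrite size_allpairs_dep sumnE big_map -[in RHS]pidxN.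
have : (nint pi m <= nint pi m)%N by [].
elim: {1 3 4 5}(nint pi m) => [|k ih] km; first by rewrite big_geq// pidx0.
rewrite big_nat_recr//= ih; last exact: ltnW.
have lt := pidx_lt km.
have kp : (k <= pidx pi m k)%N.
  by elim: k km {ih lt} => // k ih km; apply: leq_ltn_trans (ih _) (pidx_lt _);
    rewrite ltnW.
rewrite size_iota subSS.
rewrite -(subnK (ltnW lt)) addnK.
set d := (pidx pi m k.+1 - pidx pi m k)%N.
have d0 : (0 < d)%N by rewrite subn_gt0.
case: d d0 => // d _.
by rewrite subn1 addSn subSS addnC addnBA.
Qed.

End Size.
End Schauder.

(* Main.v *)
Require Import Defs.
From HB Require Import structures.
From mathcomp Require Import all_boot all_order all_algebra.
From mathcomp Require Import all_classical all_reals all_analysis.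
From mathcomp Require Import ring lra.

Import Order.TTheory GRing.Theory Num.Theory.
Import numFieldNormedType.Exports.

Local Open Scope classical_set_scope.
Local Open Scope ring_scope.

(** Both quantities are controlled by one functional. For a partition with
    points t_j, let E_n be the integral of |f'|^p, where f is the piecewise
    linear interpolation of x on pi^n, that is, the sum of
    (t_(j+1) - t_j) |slope_j|^p. It has two useful features. Inserting points
    without bending the interpolation leaves E_n unchanged. Moreover
    |pi^n|^(p-1) E_n dominates the p-variation along pi^n
    ([pvar_le_energy]), because |increment|^p = gap^(p-1) * gap |slope|^p.

    From xi to the variation: within one interval of pi^n the slopes of level
    n+1 differ from the slope of level n by at most
    sqrt (2 / min gap) * sum |theta| ([slope_fluctuation]), since each theta is,
    up to normalisation, the difference between an average slope and the next
    slope. Splitting |a + b|^p by convexity with a weight l < 1 close to 1 gives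
      E_(n+1) <= l^(1-p) E_n + C |pi^n| |pi^(n+1)|^(-p/2) sum |theta|^p
    ([energy_step]). Multiplying by |pi^(n+1)|^(p-1), and choosing l so that
    |pi^(n+1)| <= l^2 |pi^n|, turns this into a contraction
      U_(n+1) <= l^(p-1) U_n + C xi_n,   U_n = |pi^n|^(p-1) E_n
    ([scaled_energy_recursion]). A bounded xi therefore forces a bounded U, hence
    bounded variation. An interval of pi^n may stay undivided in pi^(n+1), so the
    p-variation of the interpolation itself need not decrease in one step; the
    contraction comes from the decay of the mesh.

    From the variation to xi: each theta is at most (min gap)^(-1/2) times a sum
    of increments of level n+1 inside one interval of pi^n, and there are at most
    M of these ([block_theta_le], [theta_sum_le]); so xi_n is at most a constant
    times the variation along pi^(n+1).

    Finally, for sequences of reals, a limsup below +oo is the same as an upper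
    bound for the whole sequence ([limn_esup_lty]), which is also what
    finiteness of the norm says. *)

(** * Inequalities for real powers and recursions *)

Section RealInequalities.
Context {R : realType}.
Implicit Types (a b l p q : R).

(** Jensen's inequality for z |-> z^p at the convex combination
    l (|a| / l) + (1 - l) (|b| / (1 - l)) of |a| + |b|. The freedom in l matters:
    for l near 1 the factor of |a|^p is as close to 1 as desired, at the expense
    of the factor of |b|^p. *)
Lemma powR_norm_add_le p l a b : 1 <= p -> 0 < l < 1 ->
  `|a + b| `^ p <= l `^ (1 - p) * `|a| `^ p + (1 - l) `^ (1 - p) * `|b| `^ p.
Proof.
move=> p1 /andP[l0 l1]; have p0 : 0 < p by lra.
have weight k z : 0 < k -> 0 <= z -> k * (z / k) `^ p = k `^ (1 - p) * z `^ p.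
  move=> k0 z0; have ki : 0 <= k^-1 by rewrite invr_ge0 ltW.
  rewrite powRM// -powR_inv1 ?(ltW k0)// -powRrM mulN1r powRB ?(gt_eqF k0) ?implybT//.
  by rewrite powRr1 ?(ltW k0)// powRN; ring.
have l1' : 0 < 1 - l by lra.
rewrite -!weight//.
have ab : `|a + b| <= l * (`|a| / l) + (1 - l) * (`|b| / (1 - l)).
  have -> : l * (`|a| / l) + (1 - l) * (`|b| / (1 - l)) = `|a| + `|b|.
    by field; rewrite !gt_eqF.
  exact: ler_normD.
have x0 : 0 <= `|a| / l by rewrite divr_ge0// ltW.
have y0 : 0 <= `|b| / (1 - l) by rewrite divr_ge0// ltW.
apply: (@le_trans _ _ ((l * (`|a| / l) + (1 - l) * (`|b| / (1 - l))) `^ p)).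
  by apply: ge0_ler_powR; rewrite ?nnegrE ?(ltW p0)// addr_ge0// mulr_ge0// ltW.
have /= := @convex_powR _ p p1 (Itv01 (ltW l0) (ltW l1)) (`|a| / l) (`|b| / (1 - l)).
by rewrite !convRE/= /unstable.onem; apply; rewrite inE/= in_itv/= andbT.
Qed.

(** Every term is at most B^(1/p), where B is the sum of the p-th powers. The
    power of the number of terms is not sharp, but that number will be bounded. *)
Lemma powR_sum_le p (m n : nat) (g : nat -> R) : 0 < p ->
  (forall i, 0 <= g i) ->
  (\sum_(m <= i < n) g i) `^ p <=
    (n - m)%:R `^ p * \sum_(m <= i < n) g i `^ p.
Proof.
move=> p0 g0; set B := \sum_(m <= i < n) g i `^ p.
have B0 : 0 <= B by apply: sumr_ge0 => i _; exact: powR_ge0.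
have gB i : (m <= i < n)%N -> g i <= B `^ p^-1.
  move=> imn; have -> : g i = (g i `^ p) `^ p^-1.
    by rewrite -powRrM mulfV ?gt_eqF// powRr1.
  apply: ge0_ler_powR; rewrite ?nnegrE ?powR_ge0 ?invr_ge0 ?(ltW p0)//.
  rewrite /B (bigD1_seq i) ?mem_index_iota ?iota_uniq//= lerDl.
  by apply: sumr_ge0 => j _; exact: powR_ge0.
have -> : B = (B `^ p^-1) `^ p by rewrite -powRrM mulVf ?gt_eqF// powRr1.
rewrite -powRM ?ler0n ?powR_ge0//; apply: ge0_ler_powR.
- exact: ltW.
- by rewrite nnegrE sumr_ge0.
- by rewrite nnegrE mulr_ge0 ?powR_ge0.
- rewrite mulr_natl -sumr_const_nat; apply: ler_sum_nat => i; exact: gB.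
Qed.

(** The bound is preserved because d / (1 - q) is the fixed point of the
    recursion. *)
Lemma affine_recursion_bounded q d (u : nat -> R) : 0 <= q < 1 -> 0 <= d ->
  (forall n, u n.+1 <= q * u n + d) ->
  forall n, u n <= `|u 0| + d / (1 - q).
Proof.
move=> /andP[q0 q1] d0 step; have q1' : 0 < 1 - q by lra.
elim=> [|n ih]; first by rewrite (le_trans (ler_norm _))// lerDl divr_ge0// ltW.
apply: (le_trans (step n)).
have := ler_wpM2l q0 ih; rewrite -(lerD2r d) => /le_trans; apply.
have -> : q * (`|u 0| + d / (1 - q)) + d = q * `|u 0| + d / (1 - q).
  by field; rewrite gt_eqF.
by rewrite lerD2r ler_piMl// ltW.
Qed.

(** The powers of the mesh balance: with h and h' the meshes of levels n and n+1
    (comparable up to b) and h' / c a lower bound for the gaps of level n+1, both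
    sides are of order h^(p-1) * h * h^(-p/2). *)
Lemma powR_scaling p b c h h' : 1 < p -> 0 < b -> 0 < c -> 0 < h -> 0 < h' ->
  h' <= h -> h <= b * h' ->
  h' `^ (p - 1) * (h * (2 / (h' / c)) `^ (p / 2)) <=
  (2 * c * b) `^ (p / 2) * h `^ (p / 2).
Proof.
move=> p1 b0 c0 h0 h0' h'h hbh'; have p0 : 0 < p by lra.
have inv0 : 0 <= h^-1 by rewrite invr_ge0 ltW.
have cb0 : 0 <= 2 * c * b by rewrite !mulr_ge0 ?ltW.
have mono : h' `^ (p - 1) <= h `^ (p - 1).
  by apply: ge0_ler_powR; rewrite ?nnegrE ?subr_ge0 ?(ltW p1) ?(ltW h0) ?(ltW h0').
have inner : 2 / (h' / c) <= 2 * c * b * h^-1.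
  have -> : 2 / (h' / c) = 2 * c / h' by field; rewrite !gt_eqF.
  rewrite -[leRHS]mulrA ler_wpM2l ?mulr_ge0 ?(ltW c0)//.
  by rewrite ler_pdivlMr// mulrC ler_pdivrMr.
have outer : (2 / (h' / c)) `^ (p / 2) <= (2 * c * b * h^-1) `^ (p / 2).
  have i0 : 0 <= 2 / (h' / c) by rewrite !divr_ge0// ltW.
  have s0 : 0 <= 2 * c * b * h^-1 by exact: mulr_ge0.
  by apply: ge0_ler_powR => //; rewrite divr_ge0// ltW.
rewrite mulrA; apply: (@le_trans _ _ (h `^ p * (2 * c * b * h^-1) `^ (p / 2))).
  rewrite -(mulr_powRB1 (ltW h0) p0) (mulrC h).
  apply: ler_pM outer; rewrite ?mulr_ge0 ?powR_ge0 ?(ltW h0)//.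
  by rewrite ler_wpM2r// ltW.
have -> : h `^ p = (h ^+ 2) `^ (p / 2).
  by rewrite -powR_mulrn ?(ltW h0)// -powRrM; congr (_ `^ _); field.
rewrite -!powRM ?sqr_ge0 ?(mulr_ge0 cb0 inv0) ?(ltW h0)//.
have -> : h ^+ 2 * (2 * c * b * h^-1) = 2 * c * b * h by field; rewrite gt_eqF.
by [].
Qed.

End RealInequalities.

(** * The Schauder coefficients of a single coarse interval *)

Section Block.
Context {R : realType}.
Implicit Types (s y : nat -> R) (u v A B mu : R).

(** Here u and v are the lengths of two adjacent intervals, A and B the
    increments of a function over them. The difference of the slopes is
    theta * sqrt (1 / u + 1 / v) up to sign, and both 1 / u and 1 / v are at most
    1 / mu. *)
Lemma slope_jump_le u v A B mu : 0 < mu -> mu <= u -> mu <= v ->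
  `|B / v - A / u| <=
    Num.sqrt (2 / mu) * `|(A * v - B * u) / Num.sqrt (u * v * (u + v))|.
Proof.
move=> mu0 muu muv; have u0 : 0 < u by lra.
have v0 : 0 < v by lra.
have w0 : 0 < u * v * (u + v) by rewrite !mulr_gt0// addr_gt0.
have s0 : 0 < Num.sqrt (u * v * (u + v)) by rewrite sqrtr_gt0.
have -> : B / v - A / u = - (A * v - B * u) / (u * v).
  by field; rewrite !gt_eqF.
rewrite !normrM normrN !normfV (gtr0_norm s0) (gtr0_norm (mulr_gt0 u0 v0)).
rewrite mulrCA ler_wpM2l// ler_pdivlMr// ler_pdivrMl ?mulr_gt0//.
have -> : u * v * Num.sqrt (2 / mu) = Num.sqrt ((u * v) ^+ 2 * (2 / mu)).
  by rewrite [RHS]sqrtrM ?sqr_ge0// sqrtr_sqr gtr0_norm ?mulr_gt0.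
have r0 : 0 < (u * v) ^+ 2 * (2 / mu) by rewrite !(mulr_gt0, exprn_gt0, invr_gt0).
rewrite ler_sqrt//; last exact: ltW.
rewrite mulrA ler_pdivlMr// -subr_ge0.
have -> : (u * v) ^+ 2 * 2 - u * v * (u + v) * mu =
  u * v * (u * (v - mu) + v * (u - mu)) by ring.
by apply: mulr_ge0; [exact/ltW/mulr_gt0|rewrite addr_ge0// mulr_ge0 ?subr_ge0// ltW].
Qed.

(** The coefficients sqrt (v / (u (u + v))) of |A| and sqrt (u / (v (u + v))) of
    |B| in |theta| are both at most 1 / sqrt mu. *)
Lemma theta_le u v A B mu : 0 < mu -> mu <= u -> mu <= v ->
  Num.sqrt mu * `|(A * v - B * u) / Num.sqrt (u * v * (u + v))| <= `|A| + `|B|.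
Proof.
move=> mu0 muu muv; have u0 : 0 < u by lra.
have v0 : 0 < v by lra.
have w0 : 0 < u * v * (u + v) by rewrite !mulr_gt0// addr_gt0.
have s0 : 0 < Num.sqrt (u * v * (u + v)) by rewrite sqrtr_gt0.
rewrite normrM normfV (gtr0_norm s0) mulrA ler_pdivrMr//.
have key z : 0 < z -> mu * z ^+ 2 <= u * v * (u + v) ->
    Num.sqrt mu * z <= Num.sqrt (u * v * (u + v)).
  move=> z0 zw; have -> : Num.sqrt mu * z = Num.sqrt (mu * z ^+ 2).
    by rewrite sqrtrM ?ltW// sqrtr_sqr gtr0_norm.
  by rewrite ler_sqrt// ltW.
have kv : Num.sqrt mu * v <= Num.sqrt (u * v * (u + v)).
  apply: key => //; rewrite -subr_ge0.
  have -> : u * v * (u + v) - mu * v ^+ 2 = v * (u ^+ 2 + v * (u - mu)) by ring.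
  by rewrite mulr_ge0 ?addr_ge0 ?sqr_ge0// ?mulr_ge0 ?subr_ge0// ltW.
have ku : Num.sqrt mu * u <= Num.sqrt (u * v * (u + v)).
  apply: key => //; rewrite -subr_ge0.
  have -> : u * v * (u + v) - mu * u ^+ 2 = u * (v ^+ 2 + u * (v - mu)) by ring.
  by rewrite mulr_ge0 ?addr_ge0 ?sqr_ge0// ?mulr_ge0 ?subr_ge0// ltW.
apply: (@le_trans _ _ (Num.sqrt mu * (`|A| * v + `|B| * u))).
  rewrite ler_wpM2l ?sqrtr_ge0//; apply: (le_trans (ler_normB _ _)).
  by rewrite !normrM (gtr0_norm u0) (gtr0_norm v0).
have := ler_wpM2l (normr_ge0 A) kv; have := ler_wpM2l (normr_ge0 B) ku.
nra.
Qed.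

(** The coefficient theta_(m,k,i), with s listing the points of level m+1 from
    t^m_k on and y the values of x at them. *)
Definition block_theta s y i :=
  let u := s i.-1 - s 0 in let v := s i - s i.-1 in
  ((y i.-1 - y 0) * v - (y i - y i.-1) * u) / Num.sqrt (u * v * (u + v)).

Definition slope s y i j := (y j - y i) / (s j - s i).

Lemma block_gap s mu d i j : (forall i, (i < d)%N -> mu <= s i.+1 - s i) ->
  0 < mu -> (i < j <= d)%N -> mu <= s j - s i.
Proof.
move=> gap mu0; elim: j => [//|j ih] /andP[]; rewrite ltnS leq_eqVlt.
move=> /predU1P[->|ij] jd; first exact: gap.
have := ih; rewrite ij (ltnW jd) => /(_ isT) h.
have := gap _ jd; lra.
Qed.

(** When one more point is appended, the average slope from the start moves
    towards the slope of the last piece, being a convex combination of the two,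
    and their distance is controlled by the new theta. Neither the old slopes nor
    the last one can thus get further from the average than by that amount, which
    gives the sum by induction on the number of pieces. *)
Lemma slope_fluctuation s y mu d :
  0 < mu -> (forall i, (i < d)%N -> mu <= s i.+1 - s i) ->
  forall i, (i < d)%N -> `|slope s y i i.+1 - slope s y 0 d| <=
    Num.sqrt (2 / mu) * \sum_(2 <= j < d.+1) `|block_theta s y j|.
Proof.
move=> mu0; elim: d => [//|d ih] gap i.
have [->|d0] := posnP d.
  by rewrite ltnS leqn0 => /eqP->; rewrite subrr normr0 big_geq// mulr0.
have gap' j : (j < d)%N -> mu <= s j.+1 - s j by move=> jd; exact/gap/ltnW.
have u0 : mu <= s d - s 0 by apply: (block_gap _ _ _ _ _ gap'); rewrite ?d0/=.
have v0 : mu <= s d.+1 - s d by exact: gap.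
have jump : `|slope s y d d.+1 - slope s y 0 d| <=
    Num.sqrt (2 / mu) * `|block_theta s y d.+1| by exact: slope_jump_le.
have convex : slope s y 0 d.+1 = slope s y 0 d +
    (s d.+1 - s d) / (s d.+1 - s 0) * (slope s y d d.+1 - slope s y 0 d).
  have -> : s d.+1 - s 0 = (s d - s 0) + (s d.+1 - s d) by ring.
  by rewrite /slope; field; rewrite !gt_eqF//; lra.
have w : 0 <= (s d.+1 - s d) / (s d.+1 - s 0) <= 1.
  by rewrite divr_ge0 ?ler_pdivrMr ?mul1r//=; lra.
have S0 : 0 <= Num.sqrt (2 / mu) * \sum_(2 <= j < d.+1) `|block_theta s y j|.
  by rewrite mulr_ge0 ?sqrtr_ge0 ?sumr_ge0.
rewrite big_nat_recr//= mulrDr.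
move: w convex; set w := (s d.+1 - s d) / (s d.+1 - s 0) => /andP[w0 w1].
set D := slope s y d d.+1 - slope s y 0 d in jump * => ->.
rewrite ltnS leq_eqVlt => /predU1P[->|id].
  have -> : slope s y d d.+1 - (slope s y 0 d + w * D) = (1 - w) * D.
    by rewrite /D; ring.
  rewrite normrM ger0_norm ?subr_ge0//.
  have : (1 - w) * `|D| <= `|D| by rewrite ler_piMl//; lra.
  lra.
rewrite opprD addrA; apply: (le_trans (ler_normB _ _)).
rewrite lerD ?ih// normrM (ger0_norm w0).
by apply: le_trans jump; rewrite ler_piMl.
Qed.

(** The first term on the right is the energy of the unbent chord, weighted by
    convexity; the second bounds the deviation of the slopes from it. *)
Lemma block_energy_le s y mu l p d : 1 < p -> 0 < l < 1 -> 0 < mu ->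
  (forall i, (i < d)%N -> mu <= s i.+1 - s i) ->
  \sum_(0 <= i < d) (s i.+1 - s i) * `|slope s y i i.+1| `^ p <=
  l `^ (1 - p) * ((s d - s 0) * `|slope s y 0 d| `^ p) +
  (1 - l) `^ (1 - p) * ((s d - s 0) * ((2 / mu) `^ (p / 2) *
    (d%:R `^ p * \sum_(2 <= j < d.+1) `|block_theta s y j| `^ p))).
Proof.
move=> p1 l01 mu0 gap; have p0 : 0 < p by lra.
set sg := slope s y 0 d.
set K := (2 / mu) `^ (p / 2) * _.
have fluct i : (i < d)%N -> `|slope s y i i.+1 - sg| `^ p <= K.
  move=> id; have h := slope_fluctuation _ y _ _ mu0 gap i id.
  have m0 : 0 <= 2 / mu by rewrite divr_ge0// ltW.
  apply: (@le_trans _ _ ((Num.sqrt (2 / mu) *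
      \sum_(2 <= j < d.+1) `|block_theta s y j|) `^ p)).
    apply: ge0_ler_powR => //; first exact: ltW.
    by rewrite nnegrE mulr_ge0 ?sqrtr_ge0 ?sumr_ge0.
  rewrite powRM ?sqrtr_ge0 ?sumr_ge0// -powR12_sqrt// -powRrM (mulrC _ p).
  rewrite ler_wpM2l ?powR_ge0//.
  apply: (le_trans (powR_sum_le _ _ _ _ p0 _)) => //.
  rewrite ler_wpM2r ?sumr_ge0//.
  apply: ge0_ler_powR; rewrite ?nnegrE ?(ltW p0)// ler_nat.
  by case: (d) => // d'; rewrite subSS leq_subr.
rewrite -(telescope_sumr s (leq0n d)) mulr_suml mulr_sumr mulr_suml mulr_sumr.
rewrite -big_split/=; apply: ler_sum_nat => i /andP[_ id].
have g0 : 0 <= s i.+1 - s i by apply: le_trans (gap _ id); exact: ltW.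
rewrite !(mulrCA _ (s i.+1 - s i)) -mulrDr ler_wpM2l//.
have := powR_norm_add_le _ _ sg (slope s y i i.+1 - sg) (ltW p1) l01.
rewrite addrC subrK => /le_trans; apply.
by rewrite lerD2l ler_wpM2l ?powR_ge0// fluct.
Qed.

(** Both increments that enter a theta are sums of increments between
    neighbouring points, over disjoint ranges. *)
Lemma block_theta_le s y mu p d : 0 < p -> 0 < mu ->
  (forall i, (i < d)%N -> mu <= s i.+1 - s i) ->
  mu `^ (p / 2) * \sum_(2 <= j < d.+1) `|block_theta s y j| `^ p <=
  d%:R * (d%:R `^ p * \sum_(0 <= i < d) `|y i.+1 - y i| `^ p).
Proof.
move=> p0 mu0 gap; rewrite mulr_sumr.
set V := d%:R `^ p * _.
have V0 : 0 <= V by rewrite mulr_ge0 ?powR_ge0 ?sumr_ge0// => i _; exact: powR_ge0.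
have one j : (2 <= j < d.+1)%N -> mu `^ (p / 2) * `|block_theta s y j| `^ p <= V.
  case: j => // j /andP[j0]; rewrite ltnS => jd; rewrite ltnS in j0.
  have u0 : mu <= s j - s 0 by apply: (block_gap _ _ _ _ _ gap); rewrite // j0 ltnW.
  have v0 : mu <= s j.+1 - s j by exact: gap.
  have h : Num.sqrt mu * `|block_theta s y j.+1| <= `|y j - y 0| + `|y j.+1 - y j|.
    exact: theta_le.
  have h' : `|y j - y 0| + `|y j.+1 - y j| <= \sum_(0 <= i < d) `|y i.+1 - y i|.
    rewrite (big_cat_nat (n := j.+1))//= big_nat_recr//= -(telescope_sumr y (leq0n j)).
    rewrite -addrA; apply: lerD; first exact: ler_norm_sum.
    by rewrite lerDl sumr_ge0.
  have {}h := le_trans h h'.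
  have := powR_sum_le p 0 d (fun i => `|y i.+1 - y i|) p0 (fun i => normr_ge0 _).
  rewrite subn0; apply: le_trans.
  rewrite (mulrC p) powRrM powR12_sqrt ?(ltW mu0)// -powRM ?sqrtr_ge0//.
  by apply: ge0_ler_powR; rewrite ?nnegrE ?(ltW p0)// ?mulr_ge0 ?sqrtr_ge0 ?sumr_ge0.
apply: (le_trans (ler_sum_nat one)).
rewrite sumr_const_nat -[leLHS]mulr_natl ler_wpM2r// ler_nat.
by case: (d) => // d'; rewrite subSS leq_subr.
Qed.

End Block.

(** * Refining sequences of partitions *)

Section Partitions.
Context {R : realType}.
Variables (T : R) (pi : nat -> seq R).
Hypotheses (T_gt0 : 0 < T) (hpi : partition_seq T pi).

Lemma tpt_lt n i j : (i < j <= nint pi n)%N -> tpt pi n i < tpt pi n j.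
Proof.
move=> /andP[ij jN]; have [srt _] := hpi.2 n.
apply: (sorted_ltn_nth lt_trans 0 (s := pts pi n)) => //; rewrite inE /= ltnS//.
exact: leq_trans (ltnW ij) jN.
Qed.

Lemma tpt_le n i j : (i <= j <= nint pi n)%N -> tpt pi n i <= tpt pi n j.
Proof.
move=> /andP[]; rewrite leq_eqVlt => /predU1P[->//|ij jN].
by apply/ltW/tpt_lt; rewrite ij.
Qed.

Lemma tpt_nint n : tpt pi n (nint pi n) = T.
Proof. by rewrite /tpt (itv_partition_nth_size 0 (hpi.2 n)). Qed.

Lemma nint_gt0 n : (0 < nint pi n)%N.
Proof.
rewrite lt0n; apply/eqP => N0; have := tpt_nint n.
by rewrite N0 => T0; move: T_gt0; rewrite -T0 ltxx.
Qed.

Definition gap n j := tpt pi n j.+1 - tpt pi n j.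

Lemma gap_gt0 n j : (j < nint pi n)%N -> 0 < gap n j.
Proof. by move=> jN; rewrite subr_gt0 tpt_lt// ltnSn. Qed.

Lemma gap_le_mesh n j : (j < nint pi n)%N -> gap n j <= mesh pi n.
Proof.
move=> jN; apply: ub_le_sup; last first.
  by exists j => //; rewrite ger0_norm//; exact/ltW/gap_gt0.
exists T => _ [i iN <-]; rewrite ger0_norm ?(ltW (gap_gt0 _ _ iN))//.
rewrite -(tpt_nint n) lerBlDr.
apply: (@le_trans _ _ (tpt pi n (nint pi n))).
  by apply: tpt_le; rewrite leqnn andbT.
by rewrite lerDl (_ : 0 = tpt pi n 0)//; apply: tpt_le; exact: ltnW.
Qed.

Lemma mesh_gt0 n : 0 < mesh pi n.
Proof. exact: lt_le_trans (gap_gt0 n 0 (nint_gt0 n)) (gap_le_mesh _ _ (nint_gt0 n)). Qed.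

(** This is what gives content to the bound on mesh / min_mesh, as the quotient
    would be 0 for a vanishing min_mesh. *)
Lemma min_mesh_gt0 n : 0 < min_mesh pi n.
Proof.
have low N : exists2 e : R, 0 < e &
    forall j, (j < N)%N -> (j < nint pi n)%N -> e <= gap n j.
  elim: N => [|N [e e0 he]]; first by exists 1.
  have [NN|NN] := ltnP N (nint pi n); last first.
    exists e => // j; rewrite ltnS leq_eqVlt => /predU1P[->|jN]; last exact: he.
    by rewrite ltnNge NN.
  exists (Num.min e (gap n N)); first by rewrite lt_min e0 gap_gt0.
  move=> j; rewrite ltnS leq_eqVlt => /predU1P[->|jN] jn.
    by rewrite ge_min lexx orbT.
  by rewrite ge_min he.
have [e e0 he] := low (nint pi n).
apply: (lt_le_trans e0); apply: lb_le_inf.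
  by exists `|gap n 0|; exists 0%N => //; exact: nint_gt0.
by move=> _ [j jN <-]; apply: le_trans (ler_norm _); exact: he.
Qed.

Lemma min_mesh_le_gap n j : (j < nint pi n)%N -> min_mesh pi n <= gap n j.
Proof.
move=> jN; apply: ge_inf; first by exists 0 => _ [i _ <-].
by exists j => //; rewrite ger0_norm//; exact/ltW/gap_gt0.
Qed.

Lemma balanced_gap : balanced pi ->
  exists2 c : R, 0 < c &
    forall n j, (j < nint pi n)%N -> mesh pi n / c <= gap n j.
Proof.
move=> [c c1 hc]; have c0 : 0 < c by lra.
exists c => // n j jN; rewrite ler_pdivrMr// mulrC.
have := hc n; rewrite ler_pdivrMr ?min_mesh_gt0// => /le_trans; apply.
by rewrite ler_wpM2l ?min_mesh_le_gap// ltW.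
Qed.

Hypothesis href : refining pi.

Lemma tpt_pidx n k : (k <= nint pi n)%N ->
  (pidx pi n k <= nint pi n.+1)%N /\ tpt pi n.+1 (pidx pi n k) = tpt pi n k.
Proof.
move=> kN; have tin : tpt pi n k \in pts pi n.+1.
  by apply: href; rewrite mem_nth.
set j := index (tpt pi n k) (pts pi n.+1).
have jN : (j <= nint pi n.+1)%N.
  by rewrite -ltnS -[X in (_ < X)%N]/(size (pts pi n.+1)) index_mem.
have tj : tpt pi n.+1 j = tpt pi n k by rewrite /tpt nth_index.
have pj : (pidx pi n k <= j)%N.
  by rewrite leqNgt; apply/negP => /(before_find 0); rewrite -/(tpt _ _ _) tj lexx.
split; first exact: leq_trans jN.
apply/le_anti; rewrite -{1}tj tpt_le ?pj//=.
by apply: (nth_find 0); apply/hasP; exists (tpt pi n k).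
Qed.

Lemma pidx_lt n k l : (k < l <= nint pi n)%N -> (pidx pi n k < pidx pi n l)%N.
Proof.
move=> kl; have [kl' lN] := andP kl.
have [pk ek] := tpt_pidx n k (leq_trans (ltnW kl') lN).
have [pl el] := tpt_pidx n l lN.
rewrite ltnNge; apply/negP => le.
have := tpt_lt n k l kl; rewrite -ek -el ltNge tpt_le//.
by rewrite le.
Qed.

Lemma pidx0 n : pidx pi n 0 = 0%N.
Proof. by rewrite /pidx /= lexx. Qed.

Lemma pidx_nint n : pidx pi n (nint pi n) = nint pi n.+1.
Proof.
have [pN eN] := tpt_pidx n _ (leqnn (nint pi n)).
apply/eqP; rewrite eqn_leq pN leqNgt; apply/negP => lt.
have := tpt_lt n.+1 (pidx pi n (nint pi n)) (nint pi n.+1).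
by rewrite lt leqnn => /(_ isT); rewrite eN !tpt_nint ltxx.
Qed.

Definition num_subitvs n k := (pidx pi n k.+1 - pidx pi n k)%N.

Definition block n k i := tpt pi n.+1 (pidx pi n k + i).

Lemma sum_blocks n (F : nat -> R) :
  \sum_(0 <= j < nint pi n.+1) F j =
  \sum_(0 <= k < nint pi n) \sum_(0 <= i < num_subitvs n k) F (pidx pi n k + i)%N.
Proof.
rewrite -pidx_nint; move: (leqnn (nint pi n)).
elim: {1 3 4}(nint pi n) => [|k ih] kN; first by rewrite pidx0 !big_geq.
have lt : (pidx pi n k <= pidx pi n k.+1)%N by apply/ltnW/pidx_lt; rewrite ltnSn.
rewrite big_nat_recr//= -ih; last exact: ltnW.
rewrite (big_cat_nat (n := pidx pi n k))//=; congr (_ + _).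
rewrite -{1}(add0n (pidx pi n k)) big_addn.
by apply: eq_bigr => i _; rewrite addnC.
Qed.

Lemma block0 n k : (k < nint pi n)%N -> block n k 0 = tpt pi n k.
Proof. by move=> kN; rewrite /block addn0; have [] := tpt_pidx n k (ltnW kN). Qed.

Lemma block_end n k : (k < nint pi n)%N -> block n k (num_subitvs n k) = tpt pi n k.+1.
Proof.
move=> kN; rewrite /block subnKC; first by have [] := tpt_pidx n k.+1 kN.
by apply/ltnW/pidx_lt; rewrite ltnSn.
Qed.

Lemma block_index_lt n k i : (k < nint pi n)%N -> (i < num_subitvs n k)%N ->
  (pidx pi n k + i < nint pi n.+1)%N.
Proof.
move=> kN; rewrite ltn_subRL => /leq_trans; apply.
by have [] := tpt_pidx n k.+1 kN.
Qed.

Lemma block_gapE n k i : block n k i.+1 - block n k i = gap n.+1 (pidx pi n k + i).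
Proof. by rewrite /block addnS. Qed.

Lemma pvarE p n x :
  pvar p pi n x = \sum_(0 <= j < nint pi n) `|x (tpt pi n j.+1) - x (tpt pi n j)| `^ p.
Proof. by rewrite big_mkord. Qed.

Lemma schauder3E x n k i : (0 < i)%N ->
  schauder3 pi x n k i = block_theta (block n k) (x \o block n k) i.
Proof.
case: i => // i _; rewrite /schauder3 /block_theta /block /= addn0 addnS subn1 /=.
by congr (_ / Num.sqrt (_ * _)); ring.
Qed.

(** * One step of refinement *)

Definition theta_sum p x n := \sum_(0 <= k < nint pi n)
  \sum_(2 <= i < (num_subitvs n k).+1) `|block_theta (block n k) (x \o block n k) i| `^ p.

Lemma xiE p x n : xi p pi x n = mesh pi n `^ (p / 2) * theta_sum p x n.
Proof.
rewrite /xi -(size_schauder_seq hpi href x); congr (_ * _).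
rewrite -(big_mkord xpredT (fun k => `|(schauder_seq pi x n)`_k| `^ p)).
rewrite -(big_nth 0 xpredT (fun t => `|t| `^ p)) big_allpairs_dep.
apply: eq_bigr => k _; rewrite big_seq_cond [RHS]big_seq_cond.
apply: eq_bigr => i; rewrite andbT mem_index_iota => /andP[i2 _].
by rewrite schauder3E// (leq_trans _ i2).
Qed.

Lemma theta_sum_ge0 p x n : 0 <= theta_sum p x n.
Proof. by apply: sumr_ge0 => k _; apply: sumr_ge0 => i _; exact: powR_ge0. Qed.

(** The integral of |f'|^p for the linear interpolation f of x along pi^n. *)
Definition energy p n x := \sum_(0 <= j < nint pi n)
  gap n j * `|slope (tpt pi n) (x \o tpt pi n) j j.+1| `^ p.

Lemma energy_ge0 p n x : 0 <= energy p n x.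
Proof.
rewrite /energy big_mkord; apply: sumr_ge0 => j _.
by rewrite mulr_ge0 ?powR_ge0// ltW// gap_gt0.
Qed.

Lemma pvar_le_energy p n x : 1 < p ->
  pvar p pi n x <= mesh pi n `^ (p - 1) * energy p n x.
Proof.
move=> p1; rewrite pvarE mulr_sumr; apply: ler_sum_nat => j /andP[_ jN].
have g0 := gap_gt0 n j jN; have p0 : 0 < p by lra.
have -> : x (tpt pi n j.+1) - x (tpt pi n j) =
    gap n j * slope (tpt pi n) (x \o tpt pi n) j j.+1.
  by rewrite /slope/= -/(gap n j) mulrC divfK// gt_eqF.
rewrite normrM gtr0_norm// powRM ?(ltW g0)// mulrA ler_wpM2r ?powR_ge0//.
rewrite -mulr_powRB1 ?(ltW g0)// mulrC ler_wpM2r ?(ltW g0)//.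
apply: ge0_ler_powR; rewrite ?nnegrE ?(ltW g0) ?(ltW (mesh_gt0 n)) ?gap_le_mesh//.
by rewrite subr_ge0 ltW.
Qed.

Lemma theta_sum_le p x n mu M : 0 < p -> 0 < mu ->
  (forall j, (j < nint pi n.+1)%N -> mu <= gap n.+1 j) ->
  (forall k, (k < nint pi n)%N -> (num_subitvs n k <= M)%N) ->
  mu `^ (p / 2) * theta_sum p x n <= M%:R * M%:R `^ p * pvar p pi n.+1 x.
Proof.
move=> p0 mu0 hmu hM; rewrite pvarE sum_blocks !mulr_sumr.
apply: ler_sum_nat => k /andP[_ kN].
apply: le_trans (@block_theta_le _ _ _ mu p _ p0 mu0 _) _.
  by move=> i ik; rewrite block_gapE hmu// block_index_lt.
have dM : (num_subitvs n k)%:R <= M%:R :> R by rewrite ler_nat hM.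
rewrite mulrA; under eq_bigr do rewrite /= /block addnS.
rewrite ler_wpM2r ?sumr_ge0// ler_pM ?powR_ge0//.
by apply: ge0_ler_powR; rewrite ?nnegrE// ltW.
Qed.

(** The coarse chord over the k-th interval contributes exactly its share of the
    energy of level n, since splitting a chord does not change the integral of
    |f'|^p; only the deviations from the chords cost a term in theta. *)
Lemma energy_step p x n l mu M : 1 < p -> 0 < l < 1 -> 0 < mu ->
  (forall j, (j < nint pi n.+1)%N -> mu <= gap n.+1 j) ->
  (forall k, (k < nint pi n)%N -> (num_subitvs n k <= M)%N) ->
  energy p n.+1 x <= l `^ (1 - p) * energy p n x +
    (1 - l) `^ (1 - p) * M%:R `^ p * (mesh pi n * (2 / mu) `^ (p / 2)) *
      theta_sum p x n.
Proof.
move=> p1 l01 mu0 hmu hM; have p0 : 0 < p by lra.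
rewrite /energy sum_blocks /theta_sum !mulr_sumr -big_split/=.
apply: ler_sum_nat => k /andP[_ kN].
have gaps i : (i < num_subitvs n k)%N -> mu <= block n k i.+1 - block n k i.
  by move=> ik; rewrite block_gapE hmu// block_index_lt.
have := @block_energy_le _ (block n k) (x \o block n k) mu l p (num_subitvs n k)
  p1 l01 mu0 gaps.
rewrite /slope /= block0// block_end// -/(gap n k).
under eq_bigr do rewrite /block !addnS -/(gap n.+1 _).
move=> /le_trans; apply; rewrite lerD2l -!mulrA ler_wpM2l ?powR_ge0//.
set S := \sum_(2 <= j < _) _; have S0 : 0 <= S.
  by apply: sumr_ge0 => i _; exact: powR_ge0.
have dM : (num_subitvs n k)%:R `^ p <= M%:R `^ p :> R.
  by apply: ge0_ler_powR; rewrite ?nnegrE ?(ltW p0)// ler_nat hM.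
set m := (2 / mu) `^ (p / 2); have m0 : 0 <= m by exact: powR_ge0.
(* The length of the coarse interval is to be bounded by the mesh, and the
   number of its pieces by M. *)
have -> : gap n k * (m * ((num_subitvs n k)%:R `^ p * S)) =
    ((num_subitvs n k)%:R `^ p * gap n k) * (m * S) by ring.
have -> : M%:R `^ p * (mesh pi n * (m * S)) = (M%:R `^ p * mesh pi n) * (m * S) by ring.
rewrite ler_wpM2r ?mulr_ge0// ler_pM ?powR_ge0 ?gap_le_mesh//.
exact/ltW/gap_gt0.
Qed.

End Partitions.

(** * Finite limits superior and boundedness *)

Section Boundedness.
Context {R : realType}.
Implicit Types (u : nat -> R).

Lemma ereal_sup_range_lty u :
  (ereal_sup (range (fun n => (u n)%:E)) < +oo)%E <->
  exists B, forall n, u n <= B.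
Proof.
split=> [|[B uB]]; last first.
  apply: (@le_lt_trans _ _ B%:E); last exact: ltry.
  by apply: ge_ereal_sup => _ [n _ <-]; rewrite lee_fin.
have ub n : ((u n)%:E <= ereal_sup (range (fun n => (u n)%:E)))%E.
  by apply: ereal_sup_ubound; exists n.
case: (ereal_sup _) ub => [B| |] ub // _; last by have := ub 0%N.
by exists B => n; rewrite -lee_fin.
Qed.

(** The terms before the tail on which the sequence is bounded are finitely many
    reals, so they do not affect boundedness. *)
Lemma limn_esup_lty u :
  (limn_esup (fun n => (u n)%:E) < +oo)%E <-> exists B, forall n, u n <= B.
Proof.
split=> [/ereal_inf_lt[_ [V [N _ NV] <-]] Vfin|].
  have ub n : (N <= n)%N -> ((u n)%:E <= ereal_sup [set (u n)%:E | n in V])%E.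
    by move=> Nn; apply: ereal_sup_ubound; exists n => //; exact: NV.
  have [B uB] : exists B, forall n, (N <= n)%N -> u n <= B.
    case: (ereal_sup _) Vfin ub => [B| |] // _ ub.
      by exists B => n Nn; rewrite -lee_fin ub.
    by have := ub N (leqnn N).
  exists (`|B| + \sum_(0 <= i < N) `|u i|) => n.
  have [nN|Nn] := ltnP n N.
    apply: (le_trans (ler_norm _)).
    rewrite (bigD1_seq n) ?mem_index_iota ?iota_uniq//= addrCA lerDl.
    by rewrite addr_ge0// sumr_ge0.
  apply: (le_trans (uB _ Nn)); apply: (le_trans (ler_norm _)).
  by rewrite lerDl sumr_ge0.
move=> /ereal_sup_range_lty; apply: le_lt_trans.
by apply: ereal_inf_lbound; exists setT => //; exact: filterT.
Qed.

Lemma pvar_norm_lty (p : R) (pi : nat -> seq R) (x : R -> R) : 0 < p ->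
  (pvar_norm p pi x < +oo)%E <-> exists B, forall n, pvar p pi n x <= B.
Proof.
move=> p0; have pvar0 n : 0 <= pvar p pi n x.
  by apply: sumr_ge0 => j _; exact: powR_ge0.
rewrite /pvar_norm; split=> [fin|[B pB]].
  have : (ereal_sup (range (fun n => (pvar p pi n x `^ p^-1)%:E)) < +oo)%E.
    by move: fin; case: (ereal_sup _) => [s||]; rewrite ?ltry ?ltNyr// addey.
  move=> /ereal_sup_range_lty[B pB]; exists (B `^ p) => n.
  have -> : pvar p pi n x = (pvar p pi n x `^ p^-1) `^ p.
    by rewrite -powRrM mulVf ?gt_eqF// powRr1.
  have B0 : 0 <= B := le_trans (powR_ge0 _ _) (pB 0%N).
  by apply: ge0_ler_powR; rewrite ?nnegrE ?powR_ge0// ltW.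
apply: lte_add_pinfty; first exact: ltry.
apply/ereal_sup_range_lty; exists (B `^ p^-1) => n.
by apply: ge0_ler_powR; rewrite ?nnegrE ?invr_ge0 ?(ltW p0)// (le_trans (pvar0 n)).
Qed.

End Boundedness.

(** * Variation and Schauder coefficients *)

Section Equivalence.
Context {R : realType}.
Variables (T p : R) (pi : nat -> seq R) (x : R -> R).
Hypotheses (T_gt0 : 0 < T) (p_gt1 : 1 < p).
Hypotheses (hpi : partition_seq T pi) (href : refining pi).
Hypotheses (hbal : balanced pi) (hcomp : complete_refining pi).

Lemma xi_bounded :
  (exists B, forall n, pvar p pi n x <= B) -> exists B, forall n, xi p pi x n <= B.
Proof.
have p0 : 0 < p by apply: lt_trans p_gt1.
have [c c0 hgap] := balanced_gap _ _ T_gt0 hpi hbal.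
have [[M _ hM] [a [b [a0 b0 hab]]]] := hcomp.
move=> [B pB]; exists ((c * b) `^ (p / 2) * (M%:R * M%:R `^ p * B)) => n.
have h0 := mesh_gt0 _ _ T_gt0 hpi n; have h1 := mesh_gt0 _ _ T_gt0 hpi n.+1.
have hb : mesh pi n <= b * mesh pi n.+1.
  by have /andP[_] := hab n; rewrite ler_pdivrMr.
have mu0 : 0 < mesh pi n.+1 / c by rewrite divr_gt0.
have := theta_sum_le _ _ hpi href p x n _ M p0 mu0 (hgap n.+1) (hM n).
rewrite (xiE _ _ hpi href) => h.
have {}h := le_trans h (ler_wpM2l (mulr_ge0 (ler0n R M) (powR_ge0 M%:R p)) (pB n.+1)).
apply: le_trans (ler_wpM2l (powR_ge0 (c * b) (p / 2)) h).
have cb0 : 0 <= c * b by rewrite mulr_ge0 ?ltW.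
rewrite mulrA ler_wpM2r ?theta_sum_ge0// -powRM ?(ltW mu0)//.
have -> : c * b * (mesh pi n.+1 / c) = b * mesh pi n.+1 by field; rewrite gt_eqF.
by apply: ge0_ler_powR; rewrite ?nnegrE ?divr_ge0 ?mulr_ge0 ?(ltW p0) ?(ltW b0) ?(ltW h0) ?(ltW h1).
Qed.

(** Going from level n to n+1 divides |pi^n|^(p-1) by (1 + a)^(p-1) at least. With
    l = (1 + a)^(-1/2), the convexity factor l^(1-p) spends only half of that
    gain, and the factor l^(p-1) < 1 remains. *)
Lemma scaled_energy_recursion : exists q C : R, [/\ 0 <= q < 1, 0 <= C &
  forall n, mesh pi n.+1 `^ (p - 1) * energy pi p n.+1 x <=
    q * (mesh pi n `^ (p - 1) * energy pi p n x) + C * xi p pi x n].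
Proof.
have [c c0 hgap] := balanced_gap _ _ T_gt0 hpi hbal.
have [[M _ hM] [a [b [a0 b0 hab]]]] := hcomp.
have h_gt0 := mesh_gt0 _ _ T_gt0 hpi.
have pm1 : 0 <= p - 1 by rewrite subr_ge0 ltW.
set l := Num.sqrt (1 + a)^-1.
have l2 : l * l = (1 + a)^-1 by rewrite -expr2 sqr_sqrtr// invr_ge0; lra.
have l0 : 0 < l by rewrite sqrtr_gt0 invr_gt0; lra.
have l1 : l < 1.
  have : l * l < 1 by rewrite l2 invf_lt1; lra.
  by nra.
have l01 : 0 < l < 1 by rewrite l0.
have ll1 : l * l <= 1 by rewrite mulr_ile1// ltW.
exists (l `^ (p - 1)), ((1 - l) `^ (1 - p) * M%:R `^ p * (2 * c * b) `^ (p / 2)).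
split=> [||n]; last first.
- have h_shrink : mesh pi n.+1 <= l * l * mesh pi n.
    have /andP[+ _] := hab n; rewrite ler_pdivlMr ?h_gt0// l2 => h.
    by rewrite ler_pdivlMl//; lra.
  have hb : mesh pi n <= b * mesh pi n.+1.
    by have /andP[_] := hab n; rewrite ler_pdivrMr.
  have mu0 : 0 < mesh pi n.+1 / c by rewrite divr_gt0.
  have hle : mesh pi n.+1 <= mesh pi n.
    by apply: (le_trans h_shrink); rewrite ler_piMl// ltW.
  have := energy_step _ _ hpi href p x n l _ M p_gt1 l01 mu0 (hgap n.+1) (hM n).
  move=> /(ler_wpM2l (powR_ge0 (mesh pi n.+1) (p - 1))) /le_trans; apply.
  rewrite mulrDr; apply: lerD.
    have lK : l `^ (p - 1) * l `^ (1 - p) = 1.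
      by rewrite -powRD ?(gt_eqF l0) ?implybT// (_ : p - 1 + (1 - p) = 0) ?powRr0//; ring.
    have k0 : 0 <= l `^ (1 - p) * energy pi p n x.
      by rewrite mulr_ge0 ?powR_ge0// (energy_ge0 _ _ hpi).
    have shrink : mesh pi n.+1 `^ (p - 1) <=
        l `^ (p - 1) * l `^ (p - 1) * mesh pi n `^ (p - 1).
      rewrite -powRM ?(ltW l0)// -powRM ?mulr_ge0 ?(ltW l0) ?(ltW (h_gt0 n))//.
      by apply: ge0_ler_powR; rewrite ?nnegrE ?mulr_ge0 ?(ltW l0) ?(ltW (h_gt0 _)).
    apply: (le_trans (ler_wpM2r k0 shrink)).
    have -> : l `^ (p - 1) * l `^ (p - 1) * mesh pi n `^ (p - 1) *
        (l `^ (1 - p) * energy pi p n x) = l `^ (p - 1) * l `^ (1 - p) *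
        (l `^ (p - 1) * (mesh pi n `^ (p - 1) * energy pi p n x)) by ring.
    by rewrite lK mul1r.
  rewrite (xiE _ _ hpi href).
  have scale := powR_scaling _ _ _ _ _ p_gt1 b0 c0 (h_gt0 n) (h_gt0 n.+1) hle hb.
  set A := (1 - l) `^ (1 - p) * M%:R `^ p.
  have A0 : 0 <= A by rewrite mulr_ge0 ?powR_ge0.
  have := ler_wpM2l A0 (ler_wpM2r (theta_sum_ge0 pi p x n) scale).
  by rewrite -(mulrA A) (mulrCA _ A) -(mulrA A) !(mulrA _ _ (theta_sum pi p x n)).
- by rewrite !mulr_ge0 ?powR_ge0.
- have : l `^ (p - 1) < 1 `^ (p - 1).
    by apply: gt0_ltr_powR; rewrite ?nnegrE ?subr_gt0 ?ler01 ?(ltW l0).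
  by rewrite powR1 powR_ge0.
Qed.

Lemma pvar_bounded :
  (exists B, forall n, xi p pi x n <= B) -> exists B, forall n, pvar p pi n x <= B.
Proof.
have [q [C [q01 C0 rec]]] := scaled_energy_recursion.
move=> [B xB]; have B0 : 0 <= B.
  apply: le_trans (xB 0%N); rewrite (xiE _ _ hpi href).
  by rewrite mulr_ge0 ?powR_ge0 ?theta_sum_ge0.
set U := fun n => mesh pi n `^ (p - 1) * energy pi p n x.
have step n : U n.+1 <= q * U n + C * B.
  by apply: le_trans (rec n) _; rewrite lerD2l ler_wpM2l.
have Ubd := affine_recursion_bounded _ _ U q01 (mulr_ge0 C0 B0) step.
exists (`|U 0%N| + C * B / (1 - q)) => n.
exact: le_trans (pvar_le_energy _ _ T_gt0 hpi p n x p_gt1) (Ubd n).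
Qed.

End Equivalence.

Theorem theorem4p3 (R : realType) (T p : R) (x : R -> R) (pi : nat -> seq R)
  (T_gt0 : 0 < T) (p_gt1 : 1 < p) (x_cont : C0 T x)
  (pi_refining : vanishing_refining T pi) (pi_balanced : balanced pi)
  (pi_convergent : convergent_refining pi) :
  ((limn_esup (fun n => (pvar p pi n x)%:E) < +oo)%E <->
   (limn_esup (fun n => (xi p pi x n)%:E) < +oo)%E) /\
  (pvar_space T p pi x <->
   (limn_esup (fun n => (xi p pi x n)%:E) < +oo)%E).
Proof.
have [hpi href _] := pi_refining; have [hcomp _] := pi_convergent.
have bounded_iff : (exists B, forall n, pvar p pi n x <= B) <->
    (exists B, forall n, xi p pi x n <= B).
  split; first exact: xi_bounded hpi href pi_balanced hcomp.
  exact: pvar_bounded hpi href pi_balanced hcomp.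
have p_gt0 : 0 < p by lra.
split; first by split=> /limn_esup_lty/bounded_iff/limn_esup_lty.
split=> [[_ /(pvar_norm_lty _ _ _ p_gt0)]|]; first by move=> /bounded_iff/limn_esup_lty.
by move=> /limn_esup_lty/bounded_iff/(pvar_norm_lty _ _ _ p_gt0).
Qed.
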